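(* Let $f:\mathbb{R}^n\to\mathbb{R}$ be convex and twice continuously differentiable, and suppose: (1) there is $M>0$ with $\|\nabla^2 f(x)-\nabla^2 f(y)\|\le M\|x-y\|$ for all $x,y\in\mathbb{R}^n$; (2) the problem $\min_x f(x)$ has a unique solution $x^*$, which satisfies $\nabla f(x^* )=0$ and $\nabla^2f(x^* )\succeq\nu I$ for some $\nu>0$. Let $C(M,\nu)=\frac{9M}{2\nu^2}$ and $$\mathcal{LQ}_g=\Big\{x\in\mathbb{R}^n:\ \|x-x^*\|<\tfrac{2\nu}{3M},\ \|\nabla f(x)\|<\tfrac{2\nu^2}{9M}\Big\}.$$ Then there exists $\epsilon^*>0$ such that when $$0<\epsilon_g<\min\Big\{\epsilon^*,\ \frac{1}{C(M,\nu)}\Big\},$$ an $\epsilon_g$-stationary solution (a point $x$ with $\|\nabla f(x)\|\le\epsilon_g$) will be found in $O(\log\log(1/\epsilon_g))$ iterations when the point $y_k$ of Algorithm 1 (described in the context) enters $\mathcal{LQ}_g$, and $\mathrm{ET}=\text{True}$ in Algorithm 1.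
   Context: $\|\cdot\|$ is the Euclidean norm (induced $\ell_2$ norm for matrices); $\log$ is base $2$. $\kappa_H>0$, which appears as a parameter in Track 0 below, denotes the Hessian bound: $\|\nabla^2 f(x)\|\le\kappa_H$ for all $x$. $\mathrm{TR}_+$ oracle. $(d,\lambda)=\mathrm{TR}_+(x,\sigma,r)$ is the primal-dual solution of $\min_d \nabla f(x)^Td+\frac12 d^T(\nabla^2f(x)+\sigma I)d$ subject to $\|d\|\le r$, where $\lambda$ is the multiplier of the ball constraint: $\|d\|\le r$, $\lambda\ge0$, $\lambda(\|d\|-r)=0$, $(\nabla^2f(x)+\sigma I+\lambda I)d=-\nabla f(x)$, $\nabla^2f(x)+\sigma I+\lambda I\succeq0$. Algorithm 1 (Accelerated Trust-Region Method with Local Detection). Input $x_0=v_0\in\mathbb{R}^n$, $s_0=0$, stationarity tolerance $\epsilon_g>0$. For $k=0,1,2,\dots$: (a) $y_k=\frac{k}{k+3}x_k+\frac{3}{k+3}v_k$; (b) $\sigma_k=\frac{\sqrt{2M}}{2}\|\nabla f(y_k)\|^{1/2}$, $r_k=\frac{1}{\sqrt{2M}}\|\nabla f(y_k)\|^{1/2}$, $(d_k,\lambda_k)=\mathrm{TR}_+(y_k,\sigma_k,r_k)$, $x_{k+1}=y_k+d_k$; (c) if $\lambda_k=0$: set $(x_{k+1},\mathrm{ET})=\mathrm{LD}(y_k,\frac{\sqrt{2M}}{2}\|\nabla f(y_k)\|^{1/2},d_k,\epsilon_g)$, and if $\mathrm{ET}$ is True, terminate and output $x_{k+1}$; (d)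 $s_{k+1}=s_k+\frac{(k+1)(k+2)}{2}\nabla f(x_{k+1})$, $v_{k+1}=v_0-\sqrt{\frac{1}{24M\|s_{k+1}\|}}\,s_{k+1}$. Subroutine $\mathrm{LD}(y,\mu_+,d_+,\epsilon_g)$ (Local Detection). Track 0 (stationary check): if $\|d_+\|\le\min\{\frac{\epsilon_g}{2\kappa_H},\sqrt{\epsilon_g/M}\}$, output $(y+d_+,\text{True})$. Track 1 (local diving): $z_0=y$; for $i=1,\dots,\lceil\log(\|\nabla f(y)\|/\epsilon_g)\rceil$: $z_i=z_{i-1}-\nabla^2f(z_{i-1})^{-1}\nabla f(z_{i-1})$; if $\|\nabla f(z_i)\|\le\epsilon_g$ output $(z_i,\text{True})$. Track 2 (ratio bracketing and bisection): if $\mu_+/\|d_+\|\le2M$ output $(y+d_+,\text{False})$. Otherwise set $r_-=\|d_+\|$, $r_+=\|(\nabla^2f(y)+M\|d_+\|I)^{-1}\nabla f(y)\|$ and repeat: $r=\frac{r_-+r_+}{2}$, $(d,\mu)=\mathrm{TR}_+(y,0,r)$; if $\mu/\|d\|<M$ set $r_+=r$; if $\mu/\|d\|>2M$ set $r_-=r$; otherwise output $(y+d,\text{False})$.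
   Formalization: ET = True is asserted only when y_k is not already ε_g-stationary; otherwise it can fail: for f(x)=x²/2, M=ν=κ_H=1 and x_0=ε_g small, Tracks 0 and 1 output nothing and Track 2 returns ET = False. *)

(* Defs.v *)
From HB Require Import structures.
From mathcomp Require Import all_boot all_order all_algebra.
From mathcomp Require Import all_classical all_reals all_analysis.
Import Order.TTheory GRing.Theory Num.Theory.
Import numFieldNormedType.Exports.

Set Implicit Arguments.
Unset Strict Implicit.
Unset Printing Implicit Defensive.

Local Open Scope classical_set_scope.
Local Open Scope ring_scope.

(* Points of R^n are row vectors, so a matrix [A] acts by [u *m A].  This is the
   convention of the library's Jacobian ['J], and it is immaterial for Hessians
   of C^2 functions, which are symmetric.  The library norm [`|u|] on matrices
   is the sup norm: it is used only through the topology it induces, and all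
   quantitative statements use [enorm] and [opnorm]. *)

Section Euclidean.
Context {R : realType} {n : nat}.

Definition dot (u v : 'rV[R]_n) : R := (u *m v^T) 0 0.

Definition enorm (u : 'rV[R]_n) : R := Num.sqrt (dot u u).

Definition opnorm (A : 'M[R]_n) : R :=
  sup [set enorm (u *m A) | u in [set u : 'rV[R]_n | enorm u <= 1]].

(* Only applied to symmetric matrices. *)
Definition psd (A : 'M[R]_n) : Prop := forall u : 'rV[R]_n, 0 <= dot (u *m A) u.

End Euclidean.

Section Calculus.
Context {R : realType} {n : nat}.
Implicit Types (f : 'rV[R]_n -> R) (x : 'rV[R]_n).

Definition grad f x : 'rV[R]_n := \row_(i < n) 'D_(delta_mx 0 i) f x.

Definition hess f x : 'M[R]_n := 'J (grad f) x.

Definition twice_continuously_differentiable f : Prop :=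
  [/\ forall x, differentiable f x,
      forall x, differentiable (grad f) x
    & continuous (hess f)].

Definition stationary f (eps : R) x : Prop := enorm (grad f x) <= eps.

End Calculus.

Definition log2 {R : realType} (t : R) : R := ln t / ln 2.

(* [TRplus f x sigma r d lam]: (d, lam) is a possible answer of the oracle
   TR_+(x, sigma, r).  A relation, since the multiplier or the minimizer need
   not be unique in degenerate cases. *)
Definition tr_model {R : realType} {n : nat} (f : 'rV[R]_n -> R)
    (x : 'rV[R]_n) (sigma : R) (d : 'rV[R]_n) : R :=
  dot (grad f x) d + 2^-1 * dot (d *m (hess f x + sigma%:M)) d.

Record TRplus {R : realType} {n : nat} (f : 'rV[R]_n -> R)
    (x : 'rV[R]_n) (sigma r : R) (d : 'rV[R]_n) (lam : R) : Prop := {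
  tr_feasible : enorm d <= r ;
  tr_optimal : forall e, enorm e <= r ->
    tr_model f x sigma d <= tr_model f x sigma e ;
  tr_mult_ge0 : 0 <= lam ;
  tr_compl : lam * (enorm d - r) = 0 ;
  tr_kkt : d *m (hess f x + sigma%:M + lam%:M) = - grad f x ;
  tr_psd : psd (hess f x + sigma%:M + lam%:M) }.

Section LocalDetection.
Context {R : realType} {n : nat}.
Variables (f : 'rV[R]_n -> R) (M kappaH eps : R).

Definition newton_step (z : 'rV[R]_n) : 'rV[R]_n :=
  z - grad f z *m invmx (hess f z).

Definition newton_iter (y : 'rV[R]_n) (i : nat) : 'rV[R]_n :=
  iter i newton_step y.

Definition track0_radius : R :=
  Num.min (eps / (2 * kappaH)) (Num.sqrt (eps / M)).

(* The loop of Track 1 is empty when the ceiling is not positive. *)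
Definition track1_budget (y : 'rV[R]_n) : nat :=
  if Num.ceil (log2 (enorm (grad f y) / eps)) is Posz N then N else 0%N.

(* The loop of Track 1 gets to perform its steps 1, ..., i: none of the first
   i - 1 steps outputs.  The Hessian being invertible is required explicitly,
   as [invmx] returns its argument on singular matrices. *)
Definition track1_runs (y : 'rV[R]_n) (i : nat) : Prop :=
  (i <= track1_budget y)%N /\
  forall j, (j < i)%N ->
    hess f (newton_iter y j) \in unitmx /\
    ((0 < j)%N -> ~ stationary f eps (newton_iter y j)).

Definition track1_succeeds (y : 'rV[R]_n) (i : nat) : Prop :=
  [/\ (0 < i)%N, track1_runs y i & stationary f eps (newton_iter y i)].

Definition track1_fails (y : 'rV[R]_n) : Prop :=
  track1_runs y (track1_budget y) /\
  ((0 < track1_budget y)%N ->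
   ~ stationary f eps (newton_iter y (track1_budget y))).

(* [bisection y rm rp out m]: started from the bracket (r_-, r_+) = (rm, rp),
   the loop of Track 2 ends after m passes and outputs [out]. *)
Inductive bisection (y : 'rV[R]_n) : R -> R -> 'rV[R]_n -> nat -> Prop :=
| bisect_stop rm rp d mu :
    TRplus f y 0 ((rm + rp) / 2) d mu ->
    M <= mu / enorm d -> mu / enorm d <= 2 * M ->
    bisection y rm rp (y + d) 1
| bisect_right rm rp d mu out m :
    TRplus f y 0 ((rm + rp) / 2) d mu ->
    mu / enorm d < M ->
    bisection y rm ((rm + rp) / 2) out m -> bisection y rm rp out m.+1
| bisect_left rm rp d mu out m :
    TRplus f y 0 ((rm + rp) / 2) d mu ->
    2 * M < mu / enorm d ->
    bisection y ((rm + rp) / 2) rp out m -> bisection y rm rp out m.+1.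

(* [LD y mu d out et m]: the call LD(y, mu, d, eps) returns (out, et) after m
   inner iterations (Newton steps of Track 1, then passes of Track 2). *)
Inductive LD (y : 'rV[R]_n) (mu : R) (d : 'rV[R]_n) :
    'rV[R]_n -> bool -> nat -> Prop :=
| LD_track0 :
    enorm d <= track0_radius -> LD y mu d (y + d) true 0
| LD_track1 i :
    track0_radius < enorm d ->
    track1_succeeds y i ->
    LD y mu d (newton_iter y i) true i
| LD_track2_exit :
    track0_radius < enorm d ->
    track1_fails y ->
    mu / enorm d <= 2 * M ->
    LD y mu d (y + d) false (track1_budget y)
| LD_track2_bisect out m :
    track0_radius < enorm d ->
    track1_fails y ->
    2 * M < mu / enorm d ->
    bisection y (enorm d)
      (enorm (grad f y *m invmx (hess f y + (M * enorm d)%:M))) out m ->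
    LD y mu d out false (track1_budget y + m).

(* [alg_iteration y out et m]: steps (b) and (c) of one iteration of the
   accelerated method, started at y_k = y, set x_{k+1} = out and terminate the
   method iff [et]; m counts the inner iterations spent in LD. *)
Inductive alg_iteration (y : 'rV[R]_n) : 'rV[R]_n -> bool -> nat -> Prop :=
| alg_tr d lam :
    TRplus f y (Num.sqrt (2 * M) / 2 * Num.sqrt (enorm (grad f y)))
      ((Num.sqrt (2 * M))^-1 * Num.sqrt (enorm (grad f y))) d lam ->
    lam != 0 ->
    alg_iteration y (y + d) false 0
| alg_ld d lam out et m :
    TRplus f y (Num.sqrt (2 * M) / 2 * Num.sqrt (enorm (grad f y)))
      ((Num.sqrt (2 * M))^-1 * Num.sqrt (enorm (grad f y))) d lam ->
    lam = 0 ->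
    LD y (Num.sqrt (2 * M) / 2 * Num.sqrt (enorm (grad f y))) d out et m ->
    alg_iteration y out et m.

Definition extrapolation (k : nat) (x v : 'rV[R]_n) : 'rV[R]_n :=
  (k%:R / (k + 3)%:R) *: x + (3 / (k + 3)%:R) *: v.

(* [alg_state x0 k x v s]: the method started at x0 can reach iteration k
   without terminating, with (x_k, v_k, s_k) = (x, v, s).  If s_{k+1} = 0 then
   v_{k+1} = v_0, whatever the value of the square root. *)
Inductive alg_state (x0 : 'rV[R]_n) :
    nat -> 'rV[R]_n -> 'rV[R]_n -> 'rV[R]_n -> Prop :=
| alg_init : alg_state x0 0 x0 x0 0
| alg_next k x v s x' m s' :
    alg_state x0 k x v s ->
    alg_iteration (extrapolation k x v) x' false m ->
    s' = s + (((k + 1) * (k + 2))%:R / 2) *: grad f x' ->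
    alg_state x0 k.+1 x' (x0 - Num.sqrt (1 / (24 * M * enorm s')) *: s') s'.

(* y can occur as the point y_k of the method started at x0. *)
Definition alg_point (x0 : 'rV[R]_n) (k : nat) (y : 'rV[R]_n) : Prop :=
  exists x v s, alg_state x0 k x v s /\ y = extrapolation k x v.

End LocalDetection.

Definition unique_minimizer {R : realType} {n : nat} (f : 'rV[R]_n -> R)
    (xs : 'rV[R]_n) : Prop :=
  forall x, (forall z, f x <= f z) <-> x = xs.

Definition LQ_const {R : realType} (M nu : R) : R := 9 * M / (2 * nu ^+ 2).

Definition LQg {R : realType} {n : nat} (f : 'rV[R]_n -> R) (M nu : R)
    (xs : 'rV[R]_n) : set 'rV[R]_n :=
  [set x | enorm (x - xs) < 2 * nu / (3 * M) /\
           enorm (grad f x) < 2 * nu ^+ 2 / (9 * M)].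

(* Main.v *)
(* With t = M |z - xs| / nu, the Hessian at z is bounded below by (1 - t) nu.
   The two bounds defining LQg force t < 27/100, and a Newton step keeps
   t <= 27/100 while squaring the scaled gradient norm G = M |grad f| / nu^2,
   which starts below 2/9. Halving |grad f| at each step, the Newton iterates of
   Track 1 succeed within its budget, so that Track 2 is never reached; the
   bound G <= (1/2)^(2^i) on iterates that are not yet stationary gives the
   log log count. The multiplier of the trust-region step vanishes because
   sigma * r = |grad f y| / 2 and sigma < nu / 3, so Local Detection is called;
   and when Track 0 stops, grad f (y + d) is the Taylor remainder minus
   sigma d, both of norm at most eps / 2 since sigma <= nu <= kappaH. *)
Require Import Defs.
From HB Require Import structures.
From mathcomp Require Import all_boot all_order all_algebra.
From mathcomp Require Import all_classical all_reals all_analysis.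
From mathcomp Require Import ring lra.
Import Order.TTheory GRing.Theory Num.Theory.
Import numFieldNormedType.Exports.
Local Open Scope classical_set_scope.
Local Open Scope ring_scope.

(** * Euclidean norm, operator norm and coercive matrices *)

Section EuclideanTheory.
Context {R : realType} {n : nat}.
Implicit Types (u v w : 'rV[R]_n) (A B : 'M[R]_n) (a b c : R).

Lemma dotE u v : dot u v = \sum_i u 0 i * v 0 i.
Proof. by rewrite /dot mxE; apply: eq_bigr => i _; rewrite mxE. Qed.

Lemma dotC u v : dot u v = dot v u.
Proof. by rewrite !dotE; apply: eq_bigr => i _; rewrite mulrC. Qed.

Lemma dotDl u v w : dot (u + v) w = dot u w + dot v w.
Proof. by rewrite /dot mulmxDl mxE. Qed.

Lemma dotDr u v w : dot w (u + v) = dot w u + dot w v.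
Proof. by rewrite !(dotC w) dotDl. Qed.

Lemma dotZl a u v : dot (a *: u) v = a * dot u v.
Proof. by rewrite /dot -scalemxAl mxE. Qed.

Lemma dotZr a u v : dot v (a *: u) = a * dot v u.
Proof. by rewrite !(dotC v) dotZl. Qed.

Lemma dotNl u v : dot (- u) v = - dot u v.
Proof. by rewrite -scaleN1r dotZl mulN1r. Qed.

Lemma dotNr u v : dot v (- u) = - dot v u.
Proof. by rewrite !(dotC v) dotNl. Qed.

Lemma dotBl u v w : dot (u - v) w = dot u w - dot v w.
Proof. by rewrite dotDl dotNl. Qed.

Lemma dot_ge0 u : 0 <= dot u u.
Proof. by rewrite dotE sumr_ge0 // => i _; rewrite -expr2 sqr_ge0. Qed.

Lemma enorm_ge0 u : 0 <= enorm u. Proof. exact: sqrtr_ge0. Qed.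

Lemma sqr_enorm u : enorm u ^+ 2 = dot u u.
Proof. by rewrite sqr_sqrtr ?dot_ge0. Qed.

Lemma enorm0 : enorm (0 : 'rV[R]_n) = 0.
Proof. by rewrite /enorm /dot mul0mx mxE sqrtr0. Qed.

Lemma enorm_eq0 u : enorm u = 0 -> u = 0.
Proof.
move=> u0; have := sqr_enorm u; rewrite u0 expr0n /= dotE => /esym/eqP.
rewrite psumr_eq0 => [/allP uP|i _]; last by rewrite -expr2 sqr_ge0.
apply/rowP => i; rewrite mxE; have := uP i (mem_index_enum i).
by rewrite mulf_eq0 orbb => /eqP.
Qed.

Lemma enormZ a u : enorm (a *: u) = `|a| * enorm u.
Proof. by rewrite /enorm dotZl dotZr mulrA -expr2 sqrtrM ?sqr_ge0 // sqrtr_sqr. Qed.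

Lemma enormN u : enorm (- u) = enorm u.
Proof. by rewrite -scaleN1r enormZ normrN1 mul1r. Qed.

Lemma cauchy_schwarz u v : dot u v <= enorm u * enorm v.
Proof.
have [u0|u0] := eqVneq (enorm u) 0.
  by rewrite u0 (enorm_eq0 _ u0) /dot mul0mx mxE mul0r.
have [v0|v0] := eqVneq (enorm v) 0.
  by rewrite v0 (enorm_eq0 _ v0) dotC /dot mul0mx mxE mulr0.
have up : 0 < enorm u by rewrite lt_neqAle eq_sym u0 enorm_ge0.
have vp : 0 < enorm v by rewrite lt_neqAle eq_sym v0 enorm_ge0.
(* Expanding this square gives [2 |u| |v| (|u| |v| - dot u v) >= 0], and the positive factor
   cancels. *)
have := dot_ge0 (enorm v *: u - enorm u *: v).
rewrite dotBl !dotDr !dotNr !dotZl !dotZr -!sqr_enorm (dotC v u) => h.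
have uv : 0 < enorm u * enorm v by rewrite mulr_gt0.
rewrite -subr_ge0 -(pmulr_rge0 _ uv); nra.
Qed.

Lemma enormD u v : enorm (u + v) <= enorm u + enorm v.
Proof.
rewrite -(@ler_pXn2r _ 2) // ?nnegrE ?enorm_ge0 ?addr_ge0 ?enorm_ge0 //.
rewrite sqr_enorm dotDl !dotDr (dotC v u) -!sqr_enorm.
by have := cauchy_schwarz u v; nra.
Qed.

Lemma enormB u v : enorm (u - v) <= enorm u + enorm v.
Proof. by rewrite -(enormN v) enormD. Qed.

Lemma norm_dot u v : `|dot u v| <= enorm u * enorm v.
Proof.
rewrite ler_norml lerNl -dotNl cauchy_schwarz andbT.
by rewrite -(enormN u) cauchy_schwarz.
Qed.

Lemma norm_coord u i : `|u 0 i| <= enorm u.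
Proof.
rewrite -(@ler_pXn2r _ 2) // ?nnegrE ?enorm_ge0 // sqr_enorm dotE.
rewrite (bigD1 i) //= -expr2 real_normK ?num_real // lerDl.
by rewrite sumr_ge0 // => j _; rewrite -expr2 sqr_ge0.
Qed.

Lemma enorm_sum (I : Type) (r : seq I) (F : I -> 'rV[R]_n) :
  enorm (\sum_(i <- r) F i) <= \sum_(i <- r) enorm (F i).
Proof.
elim/big_ind2: _ => [|x a y b xa yb|//]; first by rewrite enorm0.
by rewrite (le_trans (enormD _ _)) ?lerD.
Qed.

(** A [sup] bounds the elements of its set only once the set is known to be bounded. Here each
    coordinate of [u] is at most 1, so the row norms of [A] add up to a bound. *)
Lemma opnorm_has_ubound A :
  has_ubound [set enorm (u *m A) | u in [set u : 'rV[R]_n | enorm u <= 1]].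
Proof.
exists (\sum_i enorm (row i A)) => _ [u u1 <-].
rewrite mulmx_sum_row (le_trans (enorm_sum _ _ _)) // ler_sum // => i _.
rewrite enormZ ler_piMl ?enorm_ge0 //.
by rewrite (le_trans (norm_coord _ _)).
Qed.

Lemma enorm_mulmx A u : enorm (u *m A) <= opnorm A * enorm u.
Proof.
have [u0|u0] := eqVneq (enorm u) 0.
  by rewrite u0 (enorm_eq0 _ u0) mul0mx enorm0 mulr0.
have up : 0 < enorm u by rewrite lt_neqAle eq_sym u0 enorm_ge0.
have -> : u *m A = enorm u *: (((enorm u)^-1 *: u) *m A).
  by rewrite -scalemxAl scalerA divff // scale1r.
rewrite enormZ gtr0_norm // mulrC ler_pM2r //.
apply: (ub_le_sup (opnorm_has_ubound A)).
exists ((enorm u)^-1 *: u) => //=.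
by rewrite enormZ gtr0_norm ?invr_gt0 // mulVf.
Qed.

(** A lower spectral bound stated through the quadratic form. It yields invertibility and a lower
    bound on [|u A|] without eigenvalues. *)
Definition coercive A c := forall u, c * enorm u ^+ 2 <= dot (u *m A) u.

Lemma psd_coercive A c : psd (A - c%:M) -> coercive A c.
Proof.
move=> Ac u; have := Ac u.
by rewrite mulmxBr mul_mx_scalar dotBl dotZl -sqr_enorm subr_ge0.
Qed.

Lemma coercive_psd A c : 0 <= c -> coercive A c -> psd A.
Proof. by move=> c0 Ac u; rewrite (le_trans _ (Ac u)) // mulr_ge0 ?sqr_ge0. Qed.

Lemma coercive_addscalar A c a : coercive A c -> coercive (A + a%:M) (c + a).
Proof.
move=> Ac u; rewrite mulmxDr mul_mx_scalar dotDl dotZl -sqr_enorm mulrDl.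
by rewrite lerD2r.
Qed.

(** Splitting [B = A + (B - A)], Cauchy-Schwarz limits the loss from the second term to
    [opnorm (B - A) |u|^2]. *)
Lemma coercive_perturb A B c : coercive A c -> coercive B (c - opnorm (B - A)).
Proof.
move=> Ac u; have -> : u *m B = u *m A + u *m (B - A).
  by rewrite -mulmxDr addrC subrK.
rewrite dotDl mulrBl lerD // expr2 mulrA lerNl -dotNl -mulmxN.
rewrite (le_trans (cauchy_schwarz _ _)) // ler_wpM2r ?enorm_ge0 //.
by rewrite mulmxN enormN enorm_mulmx.
Qed.

Lemma coercive_enorm A c u : coercive A c -> c * enorm u <= enorm (u *m A).
Proof.
move=> Ac; have [u0|u0] := eqVneq (enorm u) 0.
  by rewrite u0 mulr0 enorm_ge0.
have up : 0 < enorm u by rewrite lt_neqAle eq_sym u0 enorm_ge0.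
rewrite -(ler_pM2r up) -mulrA -expr2 (le_trans (Ac u)) //.
exact: cauchy_schwarz.
Qed.

Lemma coercive_unitmx A c : 0 < c -> coercive A c -> A \in unitmx.
Proof.
move=> c0 Ac; rewrite -row_free_unit; apply/inj_row_free => u uA0.
have := coercive_enorm A c u Ac; rewrite uA0 enorm0 pmulr_rle0 // => u0.
by apply: enorm_eq0; apply/le_anti; rewrite u0 enorm_ge0.
Qed.

End EuclideanTheory.

(** * Taylor remainder of a map with Lipschitz Jacobian, and symmetry of the Hessian *)

Section Taylor.
Context {R : realType} {n : nat}.
Implicit Types (x h u v w : 'rV[R]_n).

Lemma is_derive_line (g : 'rV[R]_n -> R) x h (t : R) :
  differentiable g (x + t *: h) ->
  is_derive t 1 (fun s : R => g (x + s *: h)) ('D_h g (x + t *: h)).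
Proof.
move=> dg; have gh : derivable g (x + t *: h) h by exact: diff_derivable.
have E : (fun r : R => r^-1 *: (g (x + (r *: (1 : R) + t) *: h) - g (x + t *: h)))
   = (fun r : R => r^-1 *: (g (r *: h + (x + t *: h)) - g (x + t *: h))).
  apply/funext => r; congr (_ *: (g _ - _)).
  by rewrite [r *: 1]mulr1 scalerDl addrCA.
by split; [rewrite /derivable /= E | rewrite /derive /= E].
Qed.

Lemma derive_grad (f : 'rV[R]_n -> R) x h :
  differentiable f x -> 'D_h f x = dot (grad f x) h.
Proof.
move=> df; rewrite deriveE // {1}(row_sum_delta h) linear_sum dotE.
by apply: eq_bigr => i _; rewrite linearZ /= mxE deriveE // mulrC.
Qed.

Lemma is_derive_dot (F : 'rV[R]_n -> 'rV[R]_n) x h w (t : R) :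
  (forall z, differentiable F z) ->
  is_derive t 1 (fun s : R => dot (F (x + s *: h)) w)
    (dot (h *m 'J F (x + t *: h)) w).
Proof.
move=> dF.
have dg z i : differentiable (fun z => F z 0 i) z.
  rewrite (_ : (fun z => F z 0 i) = (fun A : 'rV[R]_n => A 0 i) \o F) //.
  by apply: differentiable_comp; [exact: dF|exact: differentiable_coord].
have -> : (fun s : R => dot (F (x + s *: h)) w) =
   \sum_i (w 0 i \*: (fun s : R => F (x + s *: h) 0 i)).
  apply/funext => s; rewrite dotE fct_sumE; apply: eq_bigr => i _.
  by rewrite mulrC.
apply: is_derive_eq.
  apply: is_derive_sum => i; apply: is_deriveZ.
  exact: (is_derive_line (fun z => F z 0 i)).
rewrite dotE; apply: eq_bigr => i _; rewrite -deriveEjacobian // mulrC.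
by rewrite derive_mx ?mxE //; exact: diff_derivable.
Qed.

(** The remainder [e] is tested against itself, which reduces the estimate to the scalar mean value
    theorem. Subtracting [c / 2 * s ^ 2] makes the derivative of [p] nonpositive on the unit
    interval and produces the factor 1/2 without an integral. *)
Lemma taylor_enorm (F : 'rV[R]_n -> 'rV[R]_n) (M : R) x h :
  (forall z, differentiable F z) ->
  (forall y z, opnorm ('J F y - 'J F z) <= M * enorm (y - z)) ->
  enorm (F (x + h) - F x - h *m 'J F x) <= M / 2 * enorm h ^+ 2.
Proof.
move=> dF lipF; set e := (X in enorm X).
pose c := M * enorm h ^+ 2 * enorm e.
pose p : R -> R := (fun s : R => dot (F (x + s *: h)) e)
   - dot (h *m 'J F x) e \*: id - (c / 2) \*: (id ^+ 2).
pose dp (s : R) := dot (h *m 'J F (x + s *: h)) e - dot (h *m 'J F x) e - c * s.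
have p_dp (s : R) : is_derive s 1 p (dp s).
  apply: is_derive_eq; first by do 2 apply: is_deriveB; exact: is_derive_dot.
  rewrite /dp /= /GRing.scale /= !mulr1 expr1; congr (_ - _ - _).
  by field.
have [|s s01] := @MVT R p dp 0 1 ltr01 (fun s _ => p_dp s).
  by apply: derivable_within_continuous => s _; have := p_dp s; case.
have -> : p 1 - p 0 = enorm e ^+ 2 - c / 2.
  have pE s' : p s' = dot (F (x + s' *: h)) e - dot (h *m 'J F x) e * s'
      - c / 2 * s' ^+ 2 by [].
  rewrite !pE sqr_enorm {4}/e !dotBl scale1r scale0r addr0.
  by rewrite expr1n expr0n /=; ring.
rewrite subr0 mulr1 => E.
have dp_le0 : dp s <= 0.
  move: s01; rewrite in_itv /= => /andP[s0 s1].
  rewrite /dp -dotBl -mulmxBr subr_le0 (le_trans (cauchy_schwarz _ _)) //.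
  rewrite /c mulrAC ler_wpM2r ?enorm_ge0 // (le_trans (enorm_mulmx _ _)) //.
  rewrite expr2 mulrA mulrAC ler_wpM2r ?enorm_ge0 //.
  by rewrite (le_trans (lipF _ _)) // addrC addKr enormZ gtr0_norm // mulrA mulrAC.
(* If [e] vanishes, the right-hand side must be shown nonnegative with no sign given for [M]; the
   Lipschitz bound between [x + h] and [x] provides it. *)
have [e0|e0] := eqVneq (enorm e) 0.
  have := lipF (x + h) x; rewrite e0 {2}[x + h]addrC addrK.
  have := enorm_mulmx ('J F (x + h) - 'J F x) h.
  have := enorm_ge0 (h *m ('J F (x + h) - 'J F x)).
  by have := enorm_ge0 h; nra.
have ep : 0 < enorm e by rewrite lt_neqAle eq_sym e0 enorm_ge0.
by rewrite -(ler_pM2r ep) -expr2; move: E dp_le0; rewrite /c; nra.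
Qed.

(** Symmetry serves to complete the square in [TRplus_exists]. The Lipschitz bound makes the
    classical second-difference argument quantitative. *)
Lemma hess_sym (f : 'rV[R]_n -> R) (M : R) x u v :
  (forall z, differentiable f z) -> (forall z, differentiable (grad f) z) ->
  (forall y z, opnorm (hess f y - hess f z) <= M * enorm (y - z)) ->
  dot (u *m hess f x) v = dot (v *m hess f x) u.
Proof.
move=> df dg lipH.
have M_taylor h := taylor_enorm (grad f) M x h dg lipH.
(* The second difference of [f] along [z] and [w] is
   [s ^ 2 * dot (z *m hess f x) w] up to [O(s ^ 3)], and it is symmetric in
   [z] and [w]. *)
have second_difference w z (s : R) : 0 < s ->
    exists2 q : R, `|q| <= s * (`|M| * (enorm w + enorm z) ^+ 2) * enorm w
    & f (x + s *: z + s *: w) - f (x + s *: w) - f (x + s *: z) + f x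
      = s * (s * dot (z *m hess f x) w + s * q).
  move=> s0.
  pose p : R -> R := (fun t => f ((x + s *: z) + t *: w)) - (fun t => f (x + t *: w)).
  pose dp (t : R) := dot (grad f (x + s *: z + t *: w)) w - dot (grad f (x + t *: w)) w.
  have p_dp (t : R) : is_derive t 1 p (dp t).
    apply: is_derive_eq; first by apply: is_deriveB; exact: is_derive_line.
    by rewrite !derive_grad.
  have [|t t01] := @MVT R p dp 0 s s0 (fun t _ => p_dp t).
    by apply: derivable_within_continuous => t _; have := p_dp t; case.
  move: t01; rewrite in_itv /= => /andP[t0 ts].
  rewrite /p !fctE /= scale0r !addr0 subr0 => E.
  exists (s^-1 * (dp t - s * dot (z *m hess f x) w)); last first.
    have -> : f (x + s *: z + s *: w) - f (x + s *: w) - f (x + s *: z) + f x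
      = dp t * s by rewrite -E; ring.
    by field; rewrite gt_eqF.
  rewrite normrM gtr0_norm ?invr_gt0 // ler_pdivrMl // /dp.
  set a := s *: z + t *: w; set b := t *: w.
  (* By linearity, the error is the difference of the Taylor remainders of the gradient for the
     displacements [a] and [b]. *)
  have -> : dot (grad f (x + s *: z + b)) w - dot (grad f (x + b)) w
            - s * dot (z *m hess f x) w
     = dot ((grad f (x + a) - grad f x - a *m hess f x)
            - (grad f (x + b) - grad f x - b *m hess f x)) w.
    rewrite /a mulmxDl -scalemxAl !dotBl !dotDl dotZl addrA -/b.
    by ring.
  rewrite (le_trans (norm_dot _ _)) // !mulrA ler_wpM2r ?enorm_ge0 //.
  rewrite (le_trans (enormB _ _)) // (le_trans (lerD (M_taylor a) (M_taylor b))) //.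
  have ab : enorm a <= s * (enorm w + enorm z).
    rewrite (le_trans (enormD _ _)) // !enormZ !gtr0_norm //.
    by have := enorm_ge0 w; nra.
  have bb : enorm b <= s * (enorm w + enorm z).
    rewrite enormZ gtr0_norm //.
    by have := enorm_ge0 w; have := enorm_ge0 z; nra.
  have sq d : 0 <= d -> d <= s * (enorm w + enorm z) ->
      M / 2 * d ^+ 2 <= `|M| / 2 * (s * (enorm w + enorm z)) ^+ 2.
    move=> d0 dle; apply: (@le_trans _ _ (`|M| / 2 * d ^+ 2)).
      by rewrite ler_wpM2r ?sqr_ge0 // ler_pM2r ?invr_gt0 // ler_norm.
    by rewrite ler_wpM2l ?divr_ge0 // ler_pXn2r // nnegrE // (le_trans d0).
  have := lerD (sq _ (enorm_ge0 a) ab) (sq _ (enorm_ge0 b) bb).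
  by move/le_trans; apply; rewrite exprMn; lra.
(* The two expansions of one second difference leave only [q - r], which is at most [s * (K - 1)];
   with [s = eps / K] this is below any [eps]. The [+ 1] in [K] keeps it positive. *)
apply/eqP; rewrite -subr_eq0 -normr_le0; apply/ler_addgt0Pl => eps eps0.
pose K := `|M| * (enorm u + enorm v) ^+ 2 * (enorm u + enorm v) + 1.
have K0 : 0 < K.
  by rewrite ltr_wpDl // !mulr_ge0 ?exprn_ge0 ?addr_ge0 ?enorm_ge0.
pose s := eps / K.
have s0 : 0 < s by rewrite divr_gt0.
have [q qle Eq] := second_difference u v s s0.
have [r rle Er] := second_difference v u s s0.
have E : dot (u *m hess f x) v - dot (v *m hess f x) u = q - r.
  apply: (mulfI (lt0r_neq0 s0)); apply: (mulfI (lt0r_neq0 s0)).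
  suff : s * (s * dot (v *m hess f x) u + s * q)
       = s * (s * dot (u *m hess f x) v + s * r) by lra.
  rewrite -Eq -Er -!addrA (addrC (s *: u)); lra.
rewrite E addr0 (le_trans (ler_normB _ _)) // (le_trans (lerD qle rle)) //.
rewrite (addrC (enorm v)) -mulrDr -mulrA /s.
rewrite mulrAC ler_pdivrMr // ler_pM2l // /K; lra.
Qed.

End Taylor.

(** * Base 2 logarithms and iterated logarithms *)

Section Log2.
Context {R : realType}.
Implicit Types (t eps : R).

Lemma ln2_gt0 : 0 < ln 2 :> R.
Proof. by rewrite ln_gt0 // ltr1n. Qed.

Lemma log2_le_nat t (N : nat) : 0 < t -> log2 t <= N%:R -> t <= 2 ^+ N.
Proof.
move=> t0; rewrite /log2 ler_pdivrMr ?ln2_gt0 // mulr_natl -lnXn //.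
by rewrite ler_ln // posrE exprn_gt0.
Qed.

Lemma log2_exp (k : nat) : log2 (2 ^+ k) = k%:R :> R.
Proof. by rewrite /log2 lnXn // -[ln 2 *+ k]mulr_natl mulfK // gt_eqF ?ln2_gt0. Qed.

Lemma le_log2 s t : 0 < s -> s <= t -> log2 s <= log2 t.
Proof.
move=> s0 st; rewrite /log2 ler_pM2r ?invr_gt0 ?ln2_gt0 // ler_ln ?posrE //.
exact: lt_le_trans st.
Qed.

Lemma log2M s t : 0 < s -> 0 < t -> log2 (s * t) = log2 s + log2 t.
Proof. by move=> s0 t0; rewrite /log2 lnM ?posrE // mulrDl. Qed.

Lemma log2_gt0 t : 1 < t -> 0 < log2 t.
Proof. by move=> t1; rewrite divr_gt0 ?ln2_gt0 ?ln_gt0. Qed.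

Lemma log2_inv_ge2 eps : 0 < eps -> eps <= 4^-1 -> 2 <= log2 (1 / eps).
Proof.
move=> e0 e4; rewrite -(log2_exp 2) le_log2 ?exprn_gt0 //.
rewrite ler_pdivlMr // -ler_pdivlMl ?exprn_gt0 // mulr1.
by rewrite (le_trans e4) // lef_pV2 ?posrE ?exprn_gt0 // -natrX.
Qed.

(** This lets the additive constants of the iteration count be absorbed into a multiple of the
    double logarithm. *)
Lemma loglog_ge1 eps : 0 < eps -> eps <= 4^-1 -> 1 <= log2 (log2 (1 / eps)).
Proof.
move=> e0 e4; rewrite -[X in X <= _](log2_exp 1) le_log2 ?exprn_gt0 // expr1.
exact: log2_inv_ge2.
Qed.

(** Taking [log2] twice in [2 ^ (2 ^ j) < (1 / eps) ^ 2]; the square contributes the summand 1. *)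
Lemma double_exp_count eps (j : nat) : 0 < eps -> eps <= 4^-1 ->
  eps ^+ 2 < 2^-1 ^+ (2 ^ j) -> j%:R <= 1 + log2 (log2 (1 / eps)).
Proof.
move=> e0 e4 ej; have L2 := log2_inv_ge2 eps e0 e4.
have i0 : 0 < 1 / eps by rewrite divr_gt0.
have -> : 1 + log2 (log2 (1 / eps)) = log2 (2 * log2 (1 / eps)).
  rewrite (log2M 2 (log2 _)) //; last exact: lt_le_trans _ L2.
  by rewrite -[X in log2 X + _]expr1 log2_exp.
have -> : 2 * log2 (1 / eps) = log2 (1 / eps * (1 / eps)).
  by rewrite (log2M (1 / eps)) //; ring.
rewrite -(log2_exp j) le_log2 ?exprn_gt0 // -natrX -(log2_exp (2 ^ j)).
rewrite le_log2 ?exprn_gt0 //.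
move: ej; rewrite exprVn div1r -invfM -expr2 => ej.
by rewrite -[2 ^+ _]invrK lef_pV2 ?posrE ?invr_gt0 ?exprn_gt0 // ltW.
Qed.

End Log2.

(** * Newton's method near the minimizer *)

Section LocalConvergence.
Context {R : realType} {n : nat} (f : 'rV[R]_n -> R) (M nu kappaH : R).
Context (xs : 'rV[R]_n).
Hypotheses (f_C2 : twice_continuously_differentiable f) (M_gt0 : 0 < M).
Hypothesis hess_lipschitz : forall x y : 'rV[R]_n,
  opnorm (hess f x - hess f y) <= M * enorm (x - y).
Hypotheses (kappaH_gt0 : 0 < kappaH).
Hypothesis hess_bounded : forall x : 'rV[R]_n, opnorm (hess f x) <= kappaH.
Hypotheses (xs_crit : grad f xs = 0) (nu_gt0 : 0 < nu).
Hypothesis xs_hess : psd (hess f xs - nu%:M).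
Implicit Types (x y z d h : 'rV[R]_n).

Lemma grad_taylor x h :
  enorm (grad f (x + h) - grad f x - h *m hess f x) <= M / 2 * enorm h ^+ 2.
Proof. by case: f_C2 => _ dg _; exact: taylor_enorm. Qed.

(** The constant 27/100 lies between [1 - sqrt 5 / 3], the smaller root of [t - t ^ 2 / 2 = 2 / 9],
    and [1 - 1 / sqrt 2], above which the factor [1 / (2 (1 - t) ^ 2)] in [newton_step_grad] would
    exceed 1. *)
Let near_xs z := enorm (z - xs) <= 27 / 100 * (nu / M).

(** The normalisation in which a Newton step squares the gradient norm with constant 1. *)
Let scaled_grad z := M / nu ^+ 2 * enorm (grad f z).

(* With [t = M |z - xs| / nu], Taylor's formula at [xs] gives
   [t - t ^ 2 / 2 < 2 / 9], which together with [t < 2 / 3] forces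
   [t < 27 / 100]: the gradient bound in [LQg] is what keeps the method away
   from [t = 2 / 3], where Newton's method need not contract. *)
Lemma LQg_near z : LQg f M nu xs z -> near_xs z.
Proof.
move=> [ez gz].
have := grad_taylor xs (z - xs); rewrite [xs + _]addrC subrK xs_crit subr0.
have := coercive_enorm _ _ (z - xs) (psd_coercive _ _ xs_hess).
set h := z - xs in ez *; set a := h *m _ => ca ta.
have /(le_trans ca) : enorm a <= enorm (grad f z) + enorm (grad f z - a).
  by rewrite -{1}[a](subKr (grad f z)) enormB.
move=> {ca} ca; pose t := M * enorm h / nu.
have ht : enorm h = t * nu / M by rewrite /t; field; rewrite !gt_eqF.
rewrite /near_xs -/h leNgt; apply/negP => th.
have t1 : 27 / 100 < t.
  rewrite /t ltr_pdivlMr //; have -> : 27 / 100 * nu = M * (27 / 100 * (nu / M)).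
    by field; rewrite gt_eqF.
  by rewrite ltr_pM2l.
have t2 : t < 2 / 3.
  rewrite /t ltr_pdivrMr //; move: ez; rewrite ltr_pdivlMr; last by rewrite mulr_gt0.
  by lra.
have nM : 0 < nu ^+ 2 / M by rewrite divr_gt0 ?exprn_gt0.
have : (t - t ^+ 2 / 2) * (nu ^+ 2 / M) < 2 / 9 * (nu ^+ 2 / M).
  have -> : 2 / 9 * (nu ^+ 2 / M) = 2 * nu ^+ 2 / (9 * M).
    by field; rewrite gt_eqF.
  apply: le_lt_trans gz.
  have -> : (t - t ^+ 2 / 2) * (nu ^+ 2 / M) = nu * enorm h - M / 2 * enorm h ^+ 2.
    by rewrite ht; field; rewrite gt_eqF.
  by rewrite lerBlDr (le_trans ca) // lerD2l.
rewrite ltr_pM2r //; nra.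
Qed.

Lemma near_coercive z : near_xs z -> coercive (hess f z) (73 / 100 * nu).
Proof.
move=> zn u.
apply: le_trans (coercive_perturb _ (hess f z) _ (psd_coercive _ _ xs_hess) u).
rewrite ler_wpM2r ?sqr_ge0 //.
have := hess_lipschitz z xs.
have : M * enorm (z - xs) <= M * (27 / 100 * (nu / M)) by rewrite ler_pM2l.
have -> : M * (27 / 100 * (nu / M)) = 27 / 100 * nu by field; rewrite gt_eqF.
lra.
Qed.

Lemma near_unitmx z : near_xs z -> hess f z \in unitmx.
Proof.
by move=> /near_coercive; apply: coercive_unitmx; rewrite mulr_gt0 // divr_gt0.
Qed.

(** As [grad f xs = 0], the new error times the Hessian at [z] is the Taylor remainder from [z] to
    [xs], which is quadratic in the old error; coercivity then shows that the error does not
    grow. *)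
Lemma newton_step_near z : near_xs z -> near_xs (newton_step f z).
Proof.
move=> zn; have := near_coercive z zn; have uz := near_unitmx z zn.
move=> /coercive_enorm => /(_ (newton_step f z - xs)).
have -> : (newton_step f z - xs) *m hess f z =
    grad f (z + (xs - z)) - grad f z - (xs - z) *m hess f z.
  rewrite [z + _]addrC subrK xs_crit sub0r /newton_step addrAC mulmxBl mulmxKV //.
  by rewrite -(opprB xs z) mulNmx addrC.
move=> /le_trans/(_ (grad_taylor _ _)).
have -> : enorm (xs - z) = enorm (z - xs) by rewrite -enormN opprB.
have := enorm_ge0 (z - xs); have zn' := zn.
have : M * enorm (z - xs) <= M * (27 / 100 * (nu / M)) by rewrite ler_pM2l.
have -> : M * (27 / 100 * (nu / M)) = 27 / 100 * nu by field; rewrite gt_eqF.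
move: zn'; rewrite /near_xs; set a := enorm (z - xs); set b := enorm _.
move=> a_le aM a0 ba; apply: le_trans a_le.
have : 73 / 100 * nu * b <= 73 / 100 * nu * a.
  have na : 0 <= nu * a by rewrite mulr_ge0 // ltW.
  by have := ler_wpM2r a0 aM; lra.
by rewrite ler_pM2l // mulr_gt0.
Qed.

(** The Newton displacement [h] cancels the linear part, so the new gradient is a pure Taylor
    remainder, at most [M / 2 * |h| ^ 2]. Coercivity bounds [|h|] by [|grad f z| / (73 / 100 * nu)],
    and [2 * (73 / 100) ^ 2 > 1]. *)
Lemma newton_step_grad z :
  near_xs z -> scaled_grad (newton_step f z) <= scaled_grad z ^+ 2.
Proof.
move=> zn; have := near_coercive z zn; have uz := near_unitmx z zn.
pose h := - (grad f z *m invmx (hess f z)).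
have hH : h *m hess f z = - grad f z by rewrite mulNmx mulmxKV.
move=> /coercive_enorm => /(_ h); rewrite hH enormN.
have := grad_taylor z h; rewrite hH opprK subrK -[z + h]/(newton_step f z).
rewrite /scaled_grad; set g := enorm (grad f z); set g' := enorm _; set e := enorm h.
move=> g'e eg.
have g0 : 0 <= g := enorm_ge0 _; have e0 : 0 <= e := enorm_ge0 _.
have ne : (73 / 100 * nu) ^+ 2 * e ^+ 2 <= g ^+ 2.
  by rewrite -exprMn ler_pXn2r // nnegrE // !mulr_ge0 // ltW.
have -> : (M / nu ^+ 2 * g) ^+ 2 = M / nu ^+ 2 * (M / nu ^+ 2 * g ^+ 2) by ring.
rewrite ler_pM2l ?divr_gt0 ?exprn_gt0 // (le_trans g'e) //.
rewrite -!mulrA ler_pM2l // [leRHS]mulrC ler_pdivlMr ?exprn_gt0 //.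
by apply: le_trans ne; rewrite exprMn; have := sqr_ge0 (nu * e); rewrite exprMn; lra.
Qed.

Lemma newton_iter_near y i : LQg f M nu xs y -> near_xs (newton_iter f y i).
Proof. by move=> yL; elim: i => [|i]; [exact: LQg_near|exact: newton_step_near]. Qed.

Lemma scaled_grad_ge0 z : 0 <= scaled_grad z.
Proof. by rewrite mulr_ge0 ?enorm_ge0 // ltW // divr_gt0 ?exprn_gt0. Qed.

Lemma newton_iter_double_exp y i : LQg f M nu xs y ->
  scaled_grad (newton_iter f y i) <= 2^-1 ^+ (2 ^ i).
Proof.
move=> yL; elim: i => [|i IH].
  case: yL => _; rewrite expn0 expr1 /scaled_grad -(ltr_pM2l (_ : 0 < M / nu ^+ 2)).
    move=> /ltW/le_trans; apply.
    have -> : M / nu ^+ 2 * (2 * nu ^+ 2 / (9 * M)) = 2 / 9.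
      by field; rewrite !gt_eqF.
    lra.
  by rewrite divr_gt0 ?exprn_gt0.
apply: (le_trans (newton_step_grad _ (newton_iter_near y i yL))).
by rewrite expnSr exprM ler_pXn2r // nnegrE ?scaled_grad_ge0.
Qed.

Lemma newton_step_halves z : near_xs z -> scaled_grad z <= 2^-1 ->
  enorm (grad f (newton_step f z)) <= 2^-1 * enorm (grad f z).
Proof.
move=> /newton_step_grad sq small.
have := le_trans sq (ler_wpM2r (scaled_grad_ge0 z) small).
rewrite /scaled_grad; set a := enorm (grad f (newton_step f z)).
set b := enorm (grad f z); set c := M / nu ^+ 2.
by rewrite mulrCA ler_pM2l // divr_gt0 ?exprn_gt0.
Qed.

(** Unlike the doubly exponential bound, this one is relative to the initial gradient, the quantity
    that the logarithmic budget of Track 1 measures. *)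
Lemma newton_iter_halves y i : LQg f M nu xs y ->
  enorm (grad f (newton_iter f y i)) <= 2^-1 ^+ i * enorm (grad f y).
Proof.
move=> yL; elim: i => [|i IH]; first by rewrite expr0 mul1r.
apply: le_trans (newton_step_halves _ (newton_iter_near y i yL) _) _.
  apply: (le_trans (newton_iter_double_exp y i yL)).
  by rewrite ler_iXnr ?expn_gt0 ?invr_ge0 // invf_le1 // ler1n.
by rewrite exprS -mulrA ler_wpM2l ?invr_ge0.
Qed.

(** * One iteration of the method started in [LQg] *)

Section OneIteration.
Context (eps : R) (y : 'rV[R]_n).
Hypotheses (eps_gt0 : 0 < eps) (y_LQg : LQg f M nu xs y).

Lemma track1_budget_stationary : ~ stationary f eps y ->
  (0 < track1_budget f eps y)%N /\
  stationary f eps (newton_iter f y (track1_budget f eps y)).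
Proof.
move=> /negP; rewrite -ltNge => gy.
have lg : 0 < log2 (enorm (grad f y) / eps).
  by rewrite log2_gt0 // ltr_pdivlMr // mul1r.
rewrite /track1_budget; have := ceil_ge (log2 (enorm (grad f y) / eps)).
(* The logarithm is positive, so the ceiling cannot be negative and the budget is the ceiling
   itself. *)
case: Num.ceil => N lN; last first.
  by have := lt_le_trans lg lN; rewrite NegzE mulrNz oppr_gt0 ltrz0.
split; first by have := lt_le_trans lg lN; rewrite ltr0n.
rewrite /stationary (le_trans (newton_iter_halves y N y_LQg)) //.
have /log2_le_nat : 0 < enorm (grad f y) / eps by rewrite divr_gt0 // (lt_trans eps_gt0).
move=> /(_ N lN); by rewrite ler_pdivrMr // exprVn ler_pdivrMl ?exprn_gt0.
Qed.

(** The loop stops at its first success, hence the least good index: minimality shows that no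
    earlier step outputs, and all iterates stay where the Hessian is invertible. *)
Lemma track1_succeedsP :
  ~ stationary f eps y -> exists i, track1_succeeds f eps y i.
Proof.
move=> /track1_budget_stationary[N0 sN].
pose P i := (0 < i)%N && (enorm (grad f (newton_iter f y i)) <= eps).
have PN : P (track1_budget f eps y) by rewrite /P N0.
have exP : exists i, P i by exists (track1_budget f eps y).
exists (ex_minn exP); case: ex_minnP => i /andP[i0 si] imin; split=> //.
split; first exact: imin PN.
move=> j ji; split; first exact/near_unitmx/newton_iter_near.
by move=> j0 sj; have := imin j; rewrite /P j0 sj leqNgt ji => /(_ isT).
Qed.

Lemma track1_failsN : ~ stationary f eps y -> ~ track1_fails f eps y.
Proof. by move=> /track1_budget_stationary[N0 sN] [_ /(_ N0)]. Qed.

Let sigma : R := Num.sqrt (2 * M) / 2 * Num.sqrt (enorm (grad f y)).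
Let radius : R := (Num.sqrt (2 * M))^-1 * Num.sqrt (enorm (grad f y)).

Lemma sigma_ge0 : 0 <= sigma.
Proof. by rewrite !mulr_ge0 ?sqrtr_ge0. Qed.

Lemma sigma_lt : sigma < nu / 3.
Proof.
have s2 : sigma ^+ 2 = M / 2 * enorm (grad f y).
  rewrite /sigma !exprMn !sqr_sqrtr ?enorm_ge0 ?mulr_ge0 // ?ltW //.
  by field.
rewrite -(@ltr_pXn2r _ 2) // ?nnegrE ?sigma_ge0 ?divr_ge0 ?ltW // s2.
case: y_LQg => _; rewrite ltr_pdivlMr ?mulr_gt0 // exprMn; lra.
Qed.

Lemma sigma_radius : sigma * radius = enorm (grad f y) / 2.
Proof.
have a0 : 0 < Num.sqrt (2 * M) by rewrite sqrtr_gt0 mulr_gt0.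
rewrite -{1}(@sqr_sqrtr _ (enorm (grad f y))) ?enorm_ge0 // /sigma /radius.
by field; rewrite gt_eqF.
Qed.

(* Since [sigma * radius = |grad f y| / 2] and [sigma < nu / 3], the bound
   [|d| <= |grad f y| / (73 / 100 nu + sigma)] is below [radius]. *)
Lemma grad_lt_radius : 0 < enorm (grad f y) ->
  enorm (grad f y) < (73 / 100 * nu + sigma) * radius.
Proof.
move=> g0; have r0 : 0 < radius.
  by apply: mulr_gt0; rewrite ?invr_gt0 sqrtr_gt0 ?g0 // mulr_gt0.
have := sigma_radius; have := sigma_lt; have := nu_gt0; nra.
Qed.

(** A nonzero multiplier puts [d] on the sphere of radius [radius]; the optimality equation and
    coercivity then contradict [grad_lt_radius]. *)
Lemma TRplus_multiplier0 d lam : 0 < enorm (grad f y) ->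
  TRplus f y sigma radius d lam -> lam = 0.
Proof.
move=> g0 [_ _ lam0 compl kkt _]; apply/eqP/negPn/negP => lamN0.
move/eqP: compl; rewrite mulf_eq0 (negPf lamN0) subr_eq0 /= => /eqP dr.
have := coercive_addscalar _ _ lam (coercive_addscalar _ _ sigma
  (near_coercive _ (LQg_near _ y_LQg))).
move=> /coercive_enorm => /(_ d); rewrite kkt enormN dr.
have := grad_lt_radius g0; have : 0 <= lam * radius.
  by rewrite mulr_ge0 // !mulr_ge0 ?invr_ge0 ?sqrtr_ge0.
lra.
Qed.

(** The unconstrained minimizer of the regularized model lies inside the ball, so it answers the
    oracle with multiplier 0. *)
Lemma TRplus_exists : 0 < enorm (grad f y) ->
  exists d, TRplus f y sigma radius d 0.
Proof.
move=> g0; set A := hess f y + sigma%:M.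
have Ac : coercive A (73 / 100 * nu + sigma).
  exact/coercive_addscalar/near_coercive/LQg_near.
have c0 : 0 < 73 / 100 * nu + sigma.
  by rewrite ltr_wpDr ?sigma_ge0 // mulr_gt0 // divr_gt0.
have uA : A \in unitmx := coercive_unitmx _ _ c0 Ac.
have [d dA] : exists d, d *m A = - grad f y.
  by exists (- (grad f y *m invmx A)); rewrite mulNmx mulmxKV.
have A_sym u v : dot (u *m A) v = dot (v *m A) u.
  rewrite !mulmxDr !mul_mx_scalar !dotDl !dotZl (dotC v u).
  by case: f_C2 => df dg _; rewrite (hess_sym f M y u v).
have A0 : hess f y + sigma%:M + (0 : R)%:M = A by rewrite raddf0 addr0.
exists d; split; [|move=> e _|exact: lexx|exact: mul0r|by rewrite A0|rewrite A0].
- have := coercive_enorm _ _ d Ac; rewrite dA enormN.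
  by move=> /le_lt_trans/(_ (grad_lt_radius g0)); rewrite ltr_pM2l // => /ltW.
- rewrite /tr_model -/A.
  (* Completing the square: the model at [e] exceeds the model at [d] by half the quadratic form of
     [A] at [e - d]. *)
  have gE : grad f y = - (d *m A) by rewrite dA opprK.
  have := coercive_psd _ _ (ltW c0) Ac (e - d).
  rewrite gE mulmxBl dotBl !dotDr !dotNr !dotNl.
  rewrite (A_sym e d); lra.
- exact: coercive_psd (ltW c0) Ac.
Qed.

(** The nonzero vector rules out dimension 0, where the two Hessian bounds do not compare [nu] and
    [kappaH]. *)
Lemma nu_le_kappaH d : enorm d != 0 -> nu <= kappaH.
Proof.
move=> d0; have dp : 0 < enorm d by rewrite lt_neqAle eq_sym d0 enorm_ge0.
rewrite -(ler_pM2r dp).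
apply: (le_trans (coercive_enorm _ _ d (psd_coercive _ _ xs_hess))).
by rewrite (le_trans (enorm_mulmx _ _)) // ler_pM2r.
Qed.

(** Each entry of the minimum controls one term: [sqrt (eps / M)] the Taylor remainder,
    [eps / (2 * kappaH)] the term [sigma *: d]. *)
Lemma track0_stationary d : TRplus f y sigma radius d 0 ->
  enorm d <= track0_radius M kappaH eps -> stationary f eps (y + d).
Proof.
move=> [_ _ _ _ kkt _]; rewrite /track0_radius le_min => /andP[d1 d2].
have d3 : M * enorm d ^+ 2 <= eps.
  move: d2; rewrite -(@ler_pXn2r _ 2) ?nnegrE ?enorm_ge0 ?sqrtr_ge0 //.
  rewrite (@sqr_sqrtr _ (eps / M)); last by rewrite ltW // divr_gt0.
  by rewrite ler_pdivlMr // mulrC.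
have sd : sigma * enorm d <= eps / 2.
  have [->|d0] := eqVneq (enorm d) 0; first by rewrite mulr0 divr_ge0 // ltW.
  have sk : sigma <= kappaH.
    rewrite (le_trans (ltW sigma_lt)) //.
    by have := nu_le_kappaH d d0; have := nu_gt0; lra.
  rewrite (le_trans (ler_wpM2r (enorm_ge0 d) sk)) //.
  by move: d1; rewrite ler_pdivlMr ?mulr_gt0 //; lra.
have gE : grad f (y + d) = (grad f (y + d) - grad f y - d *m hess f y) - sigma *: d.
  move: kkt; rewrite raddf0 addr0 mulmxDr mul_mx_scalar => kkt.
  by rewrite -kkt -[RHS]addrA -opprD addrK.
rewrite /stationary gE (le_trans (enormB _ _)) // enormZ ger0_norm ?sigma_ge0 //.
by rewrite (le_trans (lerD (grad_taylor y d) sd)) //; lra.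
Qed.

Lemma alg_iteration_exists : ~ stationary f eps y ->
  exists out et m, alg_iteration f M kappaH eps y out et m.
Proof.
move=> ns; have g0 : 0 < enorm (grad f y).
  by move/negP: ns; rewrite -ltNge; exact: lt_trans.
have [d dP] := TRplus_exists g0; have [i iP] := track1_succeedsP ns.
have [d0|d0] := leP (enorm d) (track0_radius M kappaH eps).
  by exists (y + d), true, 0%N; apply: alg_ld dP erefl _; exact: LD_track0.
by exists (newton_iter f y i), true, i; apply: alg_ld dP erefl _; exact: LD_track1.
Qed.

Lemma alg_iteration_ET out et m : ~ stationary f eps y ->
  alg_iteration f M kappaH eps y out et m -> et = true.
Proof.
move=> ns; have g0 : 0 < enorm (grad f y).
  by move/negP: ns; rewrite -ltNge; exact: lt_trans.
case=> [d lam /(TRplus_multiplier0 _ _ g0) -> /eqP//|d lam out' et' m' _ _].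
by case=> // *; case: (track1_failsN ns).
Qed.

Lemma alg_iteration_count out m :
  eps <= 4^-1 -> eps <= M / nu ^+ 2 ->
  alg_iteration f M kappaH eps y out true m ->
  stationary f eps out /\ m.+1%:R <= 4 * log2 (log2 (1 / eps)).
Proof.
move=> e4 eM; have L1 := loglog_ge1 eps eps_gt0 e4.
move Eet : true => et H; case: H Eet => // d lam out' et' m' dP lam0 H Eet.
case: H Eet => // [d0 _|i d0 [i0 [_ iP] si] _].
  by rewrite lam0 in dP; split; [exact: track0_stationary|lra].
(* One Newton step is counted directly, since Track 1 does not test [y] itself. If it stops at step
   [j + 2], iterate [j + 1] is not stationary, so [j + 3] is at most 3 plus the double logarithm,
   hence at most 4 times it. *)
split=> //; case: i i0 iP si => // -[|j] _ iP _; first by lra.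
have [_ /(_ isT)/negP] := iP j.+1 (ltnSn _); rewrite -ltNge => ej.
have : j.+1%:R <= 1 + log2 (log2 (1 / eps)).
  apply: double_exp_count => //.
  apply: lt_le_trans (newton_iter_double_exp y j.+1 y_LQg).
  rewrite /scaled_grad expr2 (le_lt_trans (ler_wpM2r (ltW eps_gt0) eM)) //.
  by rewrite ltr_pM2l // divr_gt0 ?exprn_gt0.
rewrite -[j.+3%:R]natr1 -[j.+2%:R]natr1; lra.
Qed.

End OneIteration.

End LocalConvergence.

(** * Constants uniform in the starting point, the iteration and [eps] *)

Theorem theorem3p20 (R : realType) (n : nat) (f : 'rV[R]_n -> R)
    (M nu kappaH : R) (xs : 'rV[R]_n)
    (f_convex : convex_function setT f)
    (f_C2 : twice_continuously_differentiable f)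
    (M_gt0 : 0 < M)
    (hess_lipschitz : forall x y : 'rV[R]_n,
       opnorm (hess f x - hess f y) <= M * enorm (x - y))
    (kappaH_gt0 : 0 < kappaH)
    (hess_bounded : forall x : 'rV[R]_n, opnorm (hess f x) <= kappaH)
    (xs_min : unique_minimizer f xs)
    (xs_crit : grad f xs = 0)
    (nu_gt0 : 0 < nu)
    (xs_hess : psd (hess f xs - nu%:M)) :
  exists eps_star : R, 0 < eps_star /\
  exists K : R, 0 < K /\
  forall eps : R, 0 < eps -> eps < Num.min eps_star (1 / LQ_const M nu) ->
  forall (x0 : 'rV[R]_n) (k : nat) (y : 'rV[R]_n),
    alg_point f M kappaH eps x0 k y -> LQg f M nu xs y ->
    (stationary f eps y \/
     ((exists out et m, alg_iteration f M kappaH eps y out et m) /\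
      (forall out et m, alg_iteration f M kappaH eps y out et m -> et = true)))
    /\
    (forall out m, alg_iteration f M kappaH eps y out true m ->
       stationary f eps out /\ m.+1%:R <= K * log2 (log2 (1 / eps))).
Proof.
have Mnu : 0 < M / nu ^+ 2 by rewrite divr_gt0 ?exprn_gt0.
(* The bound 1/4 makes the double logarithm at least 1; the bound [M / nu ^+ 2] makes the scaled
   gradient of a point that is not stationary exceed [eps ^+ 2]. *)
exists (Num.min 4^-1 (M / nu ^+ 2)); split; first by rewrite lt_min invr_gt0 Mnu ltr0n.
exists 4; split; first by [].
move=> eps eps_gt0; rewrite !lt_min => /andP[/andP[/ltW e4 /ltW eM] _].
move=> x0 k y _ yL; split; last first.
  by move=> out m; exact: (alg_iteration_count f M nu kappaH xs).
(* If [y] is already stationary, the budget of Track 1 is 0 and Local Detection may return false,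
   but a solution has been found. *)
have [sy|/negP ns] := boolP (enorm (grad f y) <= eps); [by left|right; split].
  exact: (alg_iteration_exists f M nu kappaH xs).
by move=> out et m; exact: (alg_iteration_ET f M nu kappaH xs).
Qed.
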